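(* Let $k,n,L$ be positive integers with $2k<n$, let $q$ be a prime power, and let $\mathcal{F}$ be an $[n,k,L]_q$-AAD family. Then $$|\mathcal{F}|\le 1+L\,\frac{q^{n-k}-1}{q^k-1}.$$ Consequently, if $L=L(q)$ is a positive-integer-valued function of $q$ with $L=q^{o(1)}$ as $q\to\infty$ (in particular if $L$ is constant), then $p^{AS}(n,k,L)\le n-2k$.
   Context: Let $q$ be a prime power and $\mathbb{F}_q$ the field with $q$ elements. A partial $k$-spread in $\mathbb{F}_q^n$ is a collection of $k$-dimensional linear subspaces with pairwise trivial intersection (i.e. equal to $\{0\}$). For $u\in\mathbb{F}_q^n$ and a subspace $S$, $u+S=\{u+v: v\in S\}$. For positive integers $k,n$ with $2k<n$, a family $\mathcal{F}$ of $k$-dimensional linear subspaces of $\mathbb{F}_q^n$ is $L$-almost affinely disjoint, written $[n,k,L]_q$-AAD, if (1) $\mathcal{F}$ is a partial $k$-spread of $\mathbb{F}_q^n$, and (2) for every $S\in\mathcal{F}$ and every $u\in\mathbb{F}_q^n\setminus S$, the affine subspace $u+S$ intersects (has nonempty intersection with) at most $L$ subspaces from $\mathcal{F}$. A family $\mathcal{F}$ of $k$-dimensional linear subspaces of $\mathbb{F}_q^n$ is $L$-almost sparse, written $[n,k,L]_q$-AS, if (1) $\mathcal{F}$ is a partial $k$-spread of $\mathbb{F}_q^n$, and (2) every $(k+1)$-dimensional linear subspace of $\mathbb{F}_q^n$ intersects non-trivially (in more than $\{0\}$) at most $L$ subspaces from $\mathcal{F}$. $m^{AS}_q(n,k,L)$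 denotes the maximal cardinality of an $[n,k,L]_q$-AS family, and $$p^{AS}(n,k,L):=\limsup_{q\to\infty}\log_q\big(m^{AS}_q(n,k,L)\big),$$ with $q$ ranging over prime powers (when $L$ depends on $q$, the value $L(q)$ is used inside the limsup). *)

(* Defs.v *)
From HB Require Import structures.
From mathcomp Require Import all_boot all_order all_algebra all_field.
From mathcomp Require Import finmap.
From mathcomp Require Import all_classical all_reals all_analysis.
Set Implicit Arguments.
Unset Strict Implicit.
Unset Printing Implicit Defensive.
Import Order.TTheory GRing.Theory Num.Theory.
Import numFieldNormedType.Exports.
Local Open Scope classical_set_scope.
Local Open Scope ring_scope.

Definition prime_power (q : nat) : Prop :=
  exists p e : nat, [/\ prime p, (0 < e)%N & q = (p ^ e)%N].

Section Families.
Variables (K : finFieldType) (n : nat).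
Implicit Types (F : {fset {vspace 'rV[K]_n}}) (S T W : {vspace 'rV[K]_n}).

Definition partial_spread (k : nat) F : Prop :=
  (forall S, S \in F -> \dim S = k) /\
  (forall S T, S \in F -> T \in F -> S != T -> (S :&: T)%VS = 0%VS).

Definition affine_translate (u : 'rV[K]_n) S : {set 'rV[K]_n} :=
  ((fun v => u + v) @: S)%SET.

Definition AAD (k L : nat) F : Prop :=
  partial_spread k F /\
  (forall S u, S \in F -> u \notin S ->
     (#|` [fset T in F | ~~ [disjoint affine_translate u S & T]]%fset | <= L)%N).

Definition AS (k L : nat) F : Prop :=
  partial_spread k F /\
  (forall W, \dim W = k.+1 ->
     (#|` [fset S in F | (W :&: S)%VS != 0%VS]%fset | <= L)%N).

End Families.

(* A field with q elements is unique up to isomorphism, so these are the sizes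
   of the almost sparse families over F_q. *)
Definition AS_sizes (q n k L : nat) : set nat :=
  [set N | exists (K : finFieldType) (F : {fset {vspace 'rV[K]_n}}),
     [/\ #|K| = q, AS k L F & #|` F| = N]].

(* The default value 0 is irrelevant when q is a prime power: see [mAS_max]. *)
Definition mAS (q n k L : nat) : nat :=
  xget 0%N [set N | AS_sizes q n k L N /\
                    forall M, AS_sizes q n k L M -> (M <= N)%N].

Definition prime_power_oo : set_system nat := within prime_power \oo.

Definition pAS (R : realType) (n k : nat) (L : nat -> nat) : \bar R :=
  limf_esup
    (fun q : nat => (ln (mAS q n k (L q))%:R / ln q%:R : R)%:E)
    prime_power_oo.

(* L = q^{o(1)} as q runs to infinity through the prime powers. *)
Definition q_pow_o1 (R : realType) (L : nat -> nat) : Prop :=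
  exists e : nat -> R,
    e q @[q --> prime_power_oo] --> (0 : R) /\
    \forall q \near prime_power_oo, (L q)%:R = q%:R `^ e q.

Lemma AS_sizes_bounded q n k L M :
  AS_sizes q n k L M -> (M <= 2 ^ (q ^ n))%N.
Proof.
move=> [K [F [<- _ <-]]].
pose f (S : {vspace 'rV[K]_n}) : {set 'rV[K]_n} := finset (mem S).
have inj : injective f.
  by move=> S T /setP fST; apply/vspaceP => v; have := fST v; rewrite !inE.
have -> : (#|K| ^ n = #|{: 'rV[K]_n}|)%N by rewrite card_mx mul1n.
rewrite -cardsT -card_powerset -(size_map f).
have /card_uniqP <- : uniq (map f F) by rewrite map_inj_uniq ?fset_uniq.
by apply/subset_leq_card/fintype.subsetP => A _; rewrite powersetE finset.subsetT.
Qed.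

Lemma mAS_max q n k L : prime_power q ->
  AS_sizes q n k L (mAS q n k L) /\
  forall M, AS_sizes q n k L M -> (M <= mAS q n k L)%N.
Proof.
move=> [p [e [pp e0 ->]]]; rewrite /mAS; set A := [set N | _].
have [K _ cK] := pPrimePowerField pp e0.
have ex0 : exists N, `[< AS_sizes (p ^ e) n k L N >].
  exists 0%N; apply/asboolP; exists K, fset0.
  split=> //; split=> [|W _]; first by split=> S //.
  have -> : [fset S in fset0 | (W :&: S)%VS != 0%VS]%fset = fset0.
    by apply/fsetP => S; rewrite !inE.
  by rewrite cardfs0.
have bd N : `[< AS_sizes (p ^ e) n k L N >] ->
    (N <= 2 ^ ((p ^ e) ^ n))%N.
  by move/asboolP/AS_sizes_bounded.
case: (ex_maxnP ex0 bd) => N /asboolP AN maxN.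
have : A N by split=> // M HM; apply/maxN/asboolP.
by move=> AN'; exact: (xgetPex 0%N (ex_intro A N AN')).
Qed.

(* Main.v *)
Require Import Defs.
From HB Require Import structures.
From mathcomp Require Import all_boot all_order all_algebra all_field.
From mathcomp Require Import finmap.
From mathcomp Require Import all_classical all_reals all_analysis.
From mathcomp Require Import lra.
Set Implicit Arguments.
Unset Strict Implicit.
Unset Printing Implicit Defensive.
Import Order.TTheory GRing.Theory Num.Theory.
Import numFieldNormedType.Exports.
Local Open Scope classical_set_scope.
Local Open Scope ring_scope.

(* Fix S in F and count the pairs (u, T) with u outside S, T in F other than S,
   and u + S meeting T.  The last condition says that u lies in S + T, so each
   T accounts for q^(2k) - q^k vectors u, while each of the q^n - q^k vectors u
   accounts for at most L members T.  For the asymptotic bound, an almost sparse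
   family is almost affinely disjoint with the same L: if u + S meets T, then T
   meets the (k+1)-dimensional space S + <u> non-trivially. *)

Lemma meets_affine_translate (K : finFieldType) n (u : 'rV[K]_n)
    (S T : {vspace 'rV[K]_n}) :
  ~~ [disjoint affine_translate u S & T] = (u \in (S + T)%VS).
Proof.
apply/pred0Pn/memv_addP => [[v /andP[/imsetP[s sS ->] /= usT]]|[s sS [t tT ->]]].
  by exists (- s); rewrite ?memvN//; exists (u + s) => //; rewrite addrC addrK.
exists t; apply/andP; split => //=; apply/imsetP; exists (- s).
  by rewrite memvN.
by rewrite addrAC subrr add0r.
Qed.

Lemma AAD_double_count (K : finFieldType) n k L (F : {fset {vspace 'rV[K]_n}}) :
  AAD k L F ->
  (#|` F|.-1 * (#|K| ^ (2 * k) - #|K| ^ k) <= L * (#|K| ^ n - #|K| ^ k))%N.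
Proof.
move=> [[dimF disjF] meetF].
(* With no [S] to fix, the truncated predecessor [0.-1 = 0] makes the left side vanish. *)
have [->|[S SF]] := fset_0Vmem F; first by rewrite cardfs0.
have cardS : #|S| = (#|K| ^ k)%N by rewrite card_vspace dimF.
have countT T : T \in (F `\ S)%fset ->
    \sum_(u | u \notin S) (u \in (S + T)%VS : nat)
    = (#|K| ^ (2 * k) - #|K| ^ k)%N.
  move=> /fsetD1P[TS TF].
  have ST : (S :&: T)%VS = 0%VS by apply: disjF => //; rewrite eq_sym.
  rewrite -big_mkcondr sum1_card.
  have <- : #|(S + T)%VS| = (#|K| ^ (2 * k))%N.
    by rewrite card_vspace dimv_disjoint_sum// !dimF// mul2n addnn.
  (* Split [S + T] into its part inside [S], which is all of [S], and its part outside, which is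
     what the sum counts. *)
  rewrite -cardS -(cardID (mem S) (mem (S + T)%VS)).
  rewrite (_ : #|[predI _ & _]| = #|S|) ?addKn; last first.
    by apply: eq_card => u; rewrite !inE andbC andb_idr// => /(subvP (addvSl S T)).
  by apply: eq_card => u; rewrite !inE.
have card_out : #|[pred u | u \notin S]| = (#|K| ^ n - #|K| ^ k)%N.
  rewrite -cardS -[in (#|K| ^ n)%N](mul1n n) -card_mx -(cardC (mem S)) addKn.
  by apply: eq_card => u; rewrite !inE.
have -> : #|` F|.-1 = #|` (F `\ S)%fset| by rewrite (cardfsD1 S F) SF.
rewrite [leqLHS](_ : _ = \sum_(T <- (F `\ S)%fset)
    \sum_(u | u \notin S) (u \in (S + T)%VS : nat))%N; last first.
  by rewrite (eq_big_seq _ countT) big_const_seq count_predT iter_addn_0 mulnC.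
rewrite exchange_big/= -card_out -sum1_card big_distrr/=.
apply: leq_sum => u uS; rewrite muln1 -big_mkcond sum1_count -size_filter.
apply: leq_trans (meetF S u SF uS); apply: uniq_leq_size.
  by rewrite filter_uniq ?fset_uniq.
move=> T; rewrite mem_filter => /andP[uST /fsetD1P[_ TF]].
by rewrite !inE TF meets_affine_translate.
Qed.

Lemma AAD_card_le (R : realType) (K : finFieldType) n k L
    (F : {fset {vspace 'rV[K]_n}}) :
  (0 < k)%N -> (k <= n)%N -> AAD k L F ->
  (#|` F|%:R : R) <=
    1 + L%:R * ((#|K|%:R ^+ (n - k) - 1) / (#|K|%:R ^+ k - 1)).
Proof.
move=> k0 kn /AAD_double_count; set N := #|` F|.
have := finNzRing_gt1 K; set q := #|K| => q1 Nle.
have qk1 : 1 < q%:R ^+ k :> R by rewrite exprn_egt1 -?lt0n// ltr1n.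
have qk0 : 0 < q%:R ^+ k :> R by exact: lt_trans qk1.
rewrite -lerBlDl mulrA ler_pdivlMr ?subr_gt0//.
(* The truncated [N.-1] dominates the real number [N - 1], strictly only when [N = 0]. *)
apply: (@le_trans _ _ (N.-1%:R * (q%:R ^+ k - 1))).
  apply: ler_wpM2r; first by rewrite subr_ge0 ltW.
  by case: N {Nle} => [|N] /=; rewrite ?sub0r ?oppr_le0// -natr1 addrK.
(* The factor [q ^ k] restores the differences of the double count: [q^(2k) - q^k = q^k (q^k - 1)]
   and [q^n - q^k = q^k (q^(n-k) - 1)]. *)
rewrite -(ler_pM2l qk0).
move: Nle; rewrite -(ler_nat R) !natrM !natrB ?leq_exp2l// ?leq_pmull// !natrX.
have -> : q%:R ^+ n = q%:R ^+ k * q%:R ^+ (n - k) :> R by rewrite -exprD subnKC.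
by rewrite mul2n -addnn exprD; lra.
Qed.

Lemma AS_AAD (K : finFieldType) n k L (F : {fset {vspace 'rV[K]_n}}) :
  AS k L F -> AAD k L F.
Proof.
move=> [Fspread sparseF]; split=> // S u SF uS.
have dimW : \dim (S + <[u]>) = k.+1.
  rewrite dimv_disjoint_sum ?(Fspread.1 _ SF) ?dim_vline.
    by case: eqP uS => [->|_ _]; rewrite ?mem0v ?addn1.
  apply/eqP; rewrite -subv0; apply/subvP => v /memv_capP[vS /vlineP[c vE]].
  rewrite vE in vS *; case: (eqVneq c 0) => [->|c0]; first by rewrite scale0r mem0v.
  by rewrite rpredZeq (negbTE c0) (negbTE uS) in vS.
apply: leq_trans (sparseF _ dimW); apply/fsubset_leq_card/fsubsetP => T.
rewrite !inE /= => /andP[-> /pred0Pn[_ /andP[/imsetP[s sS ->] /= usT]]] /=.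
(* The common vector [u + s] is nonzero, since otherwise [u = - s] would lie in [S]. *)
apply/eqP => /vspaceP /(_ (u + s)).
rewrite memv_cap usT andbT memv0 addrC memv_add ?memv_line// => /esym/eqP us0.
by move: uS; rewrite -(addKr s u) us0 addr0 memvN sS.
Qed.

(** Apply the almost affinely disjoint bound to a family of maximal size. With [A = q^(n-2k) >= 1]
    and [B = q^k >= 2], the quotient [(A B - 1) / (B - 1)] is at most [2 A], and the summand 1 is
    absorbed by one more [L A]; hence the factor 3. *)
Lemma mAS_le (R : realType) q n k L :
  (0 < k)%N -> (2 * k <= n)%N -> prime_power q -> (0 < L)%N ->
  ((mAS q n k L)%:R : R) <= 3 * L%:R * q%:R ^+ (n - 2 * k).
Proof.
move=> k0 kn /(mAS_max n k L)[[K [F [<- /AS_AAD FAAD <-]]] _] L0.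
have kn' : (k <= n)%N by rewrite (leq_trans _ kn)// leq_pmull.
apply: (le_trans (AAD_card_le R k0 kn' FAAD)).
have := finNzRing_gt1 K; move: #|K| => q1 q1_gt1.
have B2 : 2 <= q1%:R ^+ k :> R.
  by rewrite -natrX ler_nat (leq_trans q1_gt1)// -{1}(expn1 q1) leq_exp2l.
have A1 : 1 <= q1%:R ^+ (n - 2 * k) :> R by rewrite exprn_ege1// ler1n ltnW.
have -> : (n - k = (n - 2 * k) + k)%N.
  by rewrite mul2n -addnn subnDA subnK// leq_subRL// addnn -mul2n.
have L1 : 1 <= L%:R :> R by rewrite ler1n.
rewrite exprD; set A := _ ^+ (n - _) in A1 *; set B := _ ^+ k in B2 *.
have ratio : (A * B - 1) / (B - 1) <= 2 * A.
  by rewrite ler_pdivrMr; nra.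
have := ler_wpM2l (le_trans ler01 L1) ratio.
have := mulr_ege1 L1 A1; nra.
Qed.

(** The upper limit is an infimum of suprema over the sets of [F], and the set where [f q <= a + e]
    is one of them. *)
Lemma limf_esup_le (R : realType) (f : nat -> R) (F : set_system nat) (a : R) :
  (forall e, 0 < e -> \forall q \near F, f q <= a + e) ->
  (limf_esup (fun q => (f q)%:E) F <= a%:E)%E.
Proof.
move=> fa; apply/lee_addgt0Pr => e e0.
apply: (@le_trans _ _ (ereal_sup
    ((fun q => (f q)%:E) @` [set q | f q <= a + e]))).
  by apply: ereal_inf_lbound; exists [set q | f q <= a + e] => //; exact: fa.
by apply: ge_ereal_sup => _ [q /= qe <-]; rewrite -EFinD lee_fin.
Qed.

#[local] Instance prime_power_oo_filter : Filter prime_power_oo.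
Proof. exact: within_filter. Qed.

Lemma near_prime_power_oo (P : nat -> Prop) :
  (\forall q \near \oo, P q) ->
  \forall q \near prime_power_oo, prime_power q /\ P q.
Proof. by apply: filterS => q Pq ppq. Qed.

Lemma cvg_cst_div_ln (R : realType) (c : R) :
  c / ln q%:R @[q --> prime_power_oo] --> (0 : R).
Proof.
apply/cvgr0Pnorm_lt => e e0.
(* The threshold forces [ln q >= (|c| + 1) / e]; the extra 1 keeps [ln q] positive when [c = 0] and
   makes the final inequality strict. *)
have := near_prime_power_oo (nbhs_infty_ger (expR ((`|c| + 1) / e))).
apply: filterS => q [_ qge].
have q0 : 0 < q%:R :> R by exact: lt_le_trans (expR_gt0 _) qge.
have lnq : (`|c| + 1) / e <= ln q%:R.
  by rewrite -(expRK ((`|c| + 1) / e)) ler_ln ?posrE ?expR_gt0.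
have lnq0 : 0 < ln q%:R :> R.
  by apply: lt_le_trans lnq; rewrite divr_gt0// ltr_pwDr.
rewrite normrM normfV (gtr0_norm lnq0) ltr_pdivrMr// mulrC.
by move: lnq; rewrite ler_pdivrMr//; apply: lt_le_trans; rewrite ltrDl.
Qed.

Lemma q_pow_o1_cst (R : realType) L : (0 < L)%N -> q_pow_o1 R (fun=> L).
Proof.
(* This exponent is the base-[q] logarithm of [L]. *)
move=> L0; exists (fun q => ln L%:R / ln q%:R); split.
  exact: cvg_cst_div_ln.
have := near_prime_power_oo (nbhs_infty_ge 2).
apply: filterS => q [_ q2].
have q0 : 0 < q%:R :> R by rewrite ltr0n ltnW.
have lnq0 : 0 < ln q%:R :> R by rewrite ln_gt0// ltr1n.
by rewrite /powR gt_eqF// divfK ?gt_eqF// lnK// posrE ltr0n.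
Qed.

(** Taking base-[q] logarithms in [mAS_le] leaves [n - 2k] plus the error [ln 3 / ln q + e q], which
    tends to 0. *)
Lemma pAS_le (R : realType) n k (L : nat -> nat) :
  (0 < k)%N -> (2 * k <= n)%N ->
  (forall q, prime_power q -> (0 < L q)%N) -> q_pow_o1 R L ->
  (pAS R n k L <= (n%:R - 2 * k%:R : R)%:E)%E.
Proof.
move=> k0 kn L0 [e [e_cvg0 Le]].
have err : ln 3 / ln q%:R + e q @[q --> prime_power_oo] --> (0 : R).
  by rewrite -[0 in X in _ --> X]addr0; apply: cvgD => //; exact: cvg_cst_div_ln.
apply: limf_esup_le => eps eps0.
have := near_prime_power_oo (nbhs_infty_ge 2).
apply: filterS3 Le (cvgr_lt _ err _ eps0) => q Lq errq [ppq q2].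
have q0 : 0 < q%:R :> R by rewrite ltr0n ltnW.
have lnq0 : 0 < ln q%:R :> R by rewrite ln_gt0// ltr1n.
have Lq0 : 0 < (L q)%:R :> R by rewrite ltr0n L0.
have bd := mAS_le R k0 kn ppq (L0 q ppq).
have bd1 : 1 <= 3 * (L q)%:R * q%:R ^+ (n - 2 * k) :> R.
  by rewrite !mulr_ege1 ?exprn_ege1 ?ler1n// ?L0// ltnW.
have -> : n%:R - 2 * k%:R = (n - 2 * k)%:R :> R by rewrite natrB// natrM.
suff : ln (mAS q n k (L q))%:R <=
    ln 3 + e q * ln q%:R + (n - 2 * k)%:R * ln q%:R :> R.
  rewrite ler_pdivrMr// => /le_trans; apply.
  have : (ln 3 / ln q%:R + e q) * ln q%:R <= eps * ln q%:R.
    by rewrite ler_pM2r// ltW.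
  by rewrite mulrDl divfK ?gt_eqF//; lra.
have -> : ln 3 + e q * ln q%:R + (n - 2 * k)%:R * ln q%:R
    = ln (3 * (L q)%:R * q%:R ^+ (n - 2 * k)) :> R.
  rewrite !lnM ?posrE ?mulr_gt0 ?exprn_gt0// lnXn// Lq ln_powR.
  by rewrite mulr_natl.
(* By convention [ln 0 = 0], so a zero maximum needs the right side to be nonnegative; [bd1]
   provides this. *)
have [->|m0] := posnP (mAS q n k (L q)); first by rewrite ln0 ?ln_ge0.
by rewrite ler_ln// posrE ?ltr0n// (lt_le_trans ltr01 bd1).
Qed.

Theorem theorem1 (R : realType) (n k : nat) (k_gt0 : (0 < k)%N)
    (ltkn : (2 * k < n)%N) :
  (forall (L q : nat) (K : finFieldType) (F : {fset {vspace 'rV[K]_n}}),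
      (0 < L)%N -> prime_power q -> #|K| = q -> AAD k L F ->
      (#|` F|%:R : R) <=
        1 + L%:R * ((q%:R ^+ (n - k) - 1) / (q%:R ^+ k - 1)))
  /\ (forall L : nat -> nat,
        (forall q, prime_power q -> (0 < L q)%N) -> q_pow_o1 R L ->
        (pAS R n k L <= (n%:R - 2 * k%:R : R)%:E)%E)
  /\ (forall L : nat, (0 < L)%N ->
        (pAS R n k (fun _ => L) <= (n%:R - 2 * k%:R : R)%:E)%E).
Proof.
have kn : (k <= n)%N by rewrite ltnW// (leq_ltn_trans _ ltkn)// leq_pmull.
split=> [L _ K F _ _ <- FAAD|]; first exact: AAD_card_le.
split=> [L L0 Lo1|L L0]; apply: pAS_le => //; try exact: ltnW.
exact: q_pow_o1_cst.
Qed.
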